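(* Let $A_q$ be a quantum cluster algebra without coefficients, regarded as an algebra over $\mathbb{Z}[q^{\pm\frac12}]$. Then every inner Poisson structure $\{-,-\}$ on $A_q$ is a standard Poisson structure; that is, there exists $\lambda\in\mathbb{Z}[q^{\pm\frac12}]$ such that $\{a,b\}=\lambda[a,b]=\lambda(ab-ba)$ for all $a,b\in A_q$.
   Context: **Ground ring.** Put $k=\mathbb{Z}[q^{\pm\frac12}]$, with $q$ a formal variable. All algebras, linear maps and brackets are over $k$. **Quantum seeds (without coefficients).** Let $\mathbb{T}_n$ be the $n$-regular tree, with the $n$ edges at each vertex labeled by $1,\dots,n$. A quantum seed at $t\in\mathbb{T}_n$ is a triple $(X(t),B(t),\Lambda(t))$ where: - $B(t)=(b_{ij})$ is an $n\times n$ integer matrix and $D$ is a positive diagonal integer matrix with $DB(t)$ skew-symmetric; - $\Lambda(t)=(\lambda_{ij})$ is an $n\times n$ skew-symmetric integer matrix with $B(t)^{\top}\Lambda(t)=D$ (so both matrices are invertible over $\mathbb{Q}$); - $X(t)=(X_t^{e_1},\dots,X_t^{e_n})$, where $e_1,\dots,e_n$ is the standard basis of $\mathbb{Z}^n$, are elements which are part of a family $X_t^{e}$ ($e\in\mathbb{Z}^n$) with $X_t^{e}X_t^{f}=q^{\frac12 e\Lambda(t)f^{\top}}X_t^{e+f}$. In particular, with $X_i=X_t^{e_i}$, one has $X_iX_j=q^{\lambda_{ij}}X_jX_i$. The quantum torus $T_t$ is the $k$-algebra with $k$-basis $\{X_t^e\}_{e\in\mathbb{Z}^n}$ and this multiplication.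 Its skew-field of fractions is denoted $\mathscr{F}_q$ (independent of $t$ up to canonical identification). **Mutation.** For $k_0\in[1,n]$ the mutation $\mu_{k_0}$ of the seed replaces $X_t^{e_{k_0}}$ by $X_t^{-e_{k_0}+[b_{k_0}]_+}+X_t^{-e_{k_0}+[-b_{k_0}]_+}$, where $b_{k_0}$ is the $k_0$-th column of $B(t)$ and $[\cdot]_+$ is the entrywise $\max\{\cdot,0\}$, and keeps the other cluster variables. The matrix $B(t)$ is replaced by $(b'_{ij})$ with $b'_{ij}=-b_{ij}$ if $i=k_0$ or $j=k_0$, and $b'_{ij}=b_{ij}+\mathrm{sgn}(b_{ik_0})[b_{ik_0}b_{k_0j}]_+$ otherwise. The matrix $\Lambda(t)$ is replaced by the matrix $(\lambda'_{ij})$ with $\lambda'_{k_0j}=-\lambda_{k_0j}+\sum_l[b_{lk_0}]_+\lambda_{lj}$ for $j\ne k_0$, $\lambda'_{ik_0}=-\lambda_{ik_0}+\sum_l[b_{lk_0}]_+\lambda_{il}$ for $i\neq k_0$, and $\lambda'_{ij}=\lambda_{ij}$ otherwise. The result is again a quantum seed. **Quantum cluster algebra.** Given seeds at all $t\in\mathbb{T}_n$ such that seeds at vertices joined by an edge labeled $k_0$ are related by $\mu_{k_0}$, the quantum cluster algebra without coefficients $A_q$ is the $k$-subalgebra of $\mathscr{F}_q$ generated by all cluster variables $X_t^{e_i}$, $t\in\mathbb{T}_n$, $i\in[1,n]$. **Poisson structures.** A Poisson structure on an associative $k$-algebra $(\mathcal{A},\cdot)$ is a $k$-bilinear Lie bracket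 $\{-,-\}$ on $\mathcal{A}$ with $\{a,bc\}=\{a,b\}c+b\{a,c\}$ for all $a,b,c$ (commutativity of $\mathcal{A}$ is not assumed). Put $\mathrm{ham}(a)=\{a,-\}$ and $[a,b]=ab-ba$. The structure is *inner* if for every $a\in\mathcal{A}$ there is $a'\in\mathcal{A}$ with $\mathrm{ham}(a)=[a',-]$. It is *standard* if there is $\lambda\in k$ with $\{-,-\}=\lambda[-,-]$. *)

(* Defs.v *)
From HB Require Import structures.
From mathcomp Require Import all_boot all_order all_algebra.
From mathcomp Require Import boolp.

Set Implicit Arguments.
Unset Strict Implicit.
Unset Printing Implicit Defensive.

Import Order.TTheory GRing.Theory Num.Theory.
Local Open Scope ring_scope.

(* The ground ring Z[q^(+-1/2)] is the subring of Frac(Z[x]) of the fractions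
   p / x^m, where x stands for q^(1/2). *)

Definition xfrac : {fraction {poly int}} := FracField.tofrac 'X.

Definition laurent_pred : {pred {fraction {poly int}}} :=
  fun f => `[< exists (p : {poly int}) (m : nat),
                 f = FracField.tofrac p / xfrac ^+ m >].

Lemma xfrac_neq0 : xfrac != 0.
Proof. by rewrite /xfrac tofrac_eq0 polyX_eq0. Qed.

Lemma laurent_subring_closed : subring_closed laurent_pred.
Proof.
have xn m : xfrac ^+ m != 0 by rewrite expf_neq0 ?xfrac_neq0.
split=> [|f g /asboolP [p [m ->]] /asboolP [r [l ->]]
         |f g /asboolP [p [m ->]] /asboolP [r [l ->]]]; apply/asboolP.
- by exists 1, 0; rewrite expr0 divr1 tofrac1.
- exists (p * 'X^l - r * 'X^m), (m + l)%N.
  rewrite tofracB !tofracM !tofracXn -/xfrac -mulNr addf_div ?xn //.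
  by rewrite mulNr exprD.
- by exists (p * r), (m + l)%N; rewrite tofracM exprD mulf_div.
Qed.

HB.instance Definition _ :=
  GRing.isSubringClosed.Build _ laurent_pred laurent_subring_closed.

Definition Zq := {f : {fraction {poly int}} | f \in laurent_pred}.

HB.instance Definition _ := [isSub of Zq for @sval _ _].
HB.instance Definition _ := [Choice of Zq by <:].
HB.instance Definition _ := [SubChoice_isSubComNzRing of Zq by <:].

Lemma qhalf_subproof (m : int) : xfrac ^ m \in laurent_pred.
Proof.
case: m => m; apply/asboolP.
  by exists 'X^m, 0; rewrite expr0 divr1 tofracXn.
by exists 1, m.+1; rewrite tofrac1 div1r.
Qed.

(* qhalf m is q^(m/2). *)
Definition qhalf (m : int) : Zq := exist _ (xfrac ^ m) (qhalf_subproof m).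

Inductive alg_gen (R : comNzRingType) (A : algType R) (G : A -> Prop) :
    A -> Prop :=
| AlgGen x : G x -> alg_gen G x
| AlgGenScalar (c : R) : alg_gen G c%:A
| AlgGenAdd x y : alg_gen G x -> alg_gen G y -> alg_gen G (x + y)
| AlgGenMul x y : alg_gen G x -> alg_gen G y -> alg_gen G (x * y).

Section GeneratedSubalgebra.
Variables (R : comNzRingType) (A : algType R) (G : A -> Prop).

Definition subalg_pred : {pred A} := fun x => `[< alg_gen G x >].

Lemma subalg_pred_closed : subalg_closed subalg_pred.
Proof.
split=> [|c x y /asboolP hx /asboolP hy|x y /asboolP hx /asboolP hy];
  apply/asboolP.
- by rewrite -[1]scale1r; apply: AlgGenScalar.
- rewrite -[x]mul1r scalerAl.
  by apply: AlgGenAdd => //; apply: AlgGenMul => //; apply: AlgGenScalar.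
- exact: AlgGenMul.
Qed.

HB.instance Definition _ :=
  GRing.isSubalgClosed.Build R A subalg_pred subalg_pred_closed.

Definition subalg := {x : A | x \in subalg_pred}.

HB.instance Definition _ := [isSub of subalg for @sval _ _].
HB.instance Definition _ := [Choice of subalg by <:].
HB.instance Definition _ := [SubChoice_isSubAlgebra of subalg by <:].

End GeneratedSubalgebra.

Section Poisson.
Variables (R : comNzRingType) (A : algType R).
Implicit Type br : A -> A -> A.

Definition commutator (a b : A) : A := a * b - b * a.

Record is_poisson br : Prop := IsPoisson {
  poisson_linearr : forall a, linear (br a);
  poisson_linearl : forall b, linear (br^~ b);
  poisson_alt : forall a, br a a = 0;
  poisson_jacobi : forall a b c,
    br a (br b c) + br b (br c a) + br c (br a b) = 0;
  poisson_leibniz : forall a b c, br a (b * c) = br a b * c + b * br a c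
}.

Definition inner_poisson br : Prop :=
  forall a, exists a', br a =1 commutator a'.

Definition standard_poisson br : Prop :=
  exists lambda : R, forall a b, br a b = lambda *: commutator a b.

End Poisson.

(* The n-regular tree is realized on the words over 'I_n without two equal
   consecutive letters; adding or removing a first letter k is crossing the
   edge labeled k. *)

Definition reduced_word n : pred (seq 'I_n) := sorted (fun i j => i != j).

Definition tree n := {w : seq 'I_n | reduced_word w}.

Definition tree_edge n (k : 'I_n) (t t' : tree n) : Prop :=
  sval t' = k :: sval t \/ sval t = k :: sval t'.

Definition pospart (x : int) : int := Num.max x 0.

Record seed (n : nat) (F : Type) := Seed {
  frame : 'rV[int]_n -> F;    (* e |-> X^e *)
  exmx : 'M[int]_n;           (* B *)
  qcmx : 'M[int]_n            (* Lambda *)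
}.

Definition evec n (i : 'I_n) : 'rV[int]_n := delta_mx 0 i.

Section QuantumSeeds.
Variables (n : nat) (F : unitAlgType Zq).
Implicit Types (s : seed n F) (d : 'rV[int]_n).

Definition skew_field : Prop := forall x : F, x != 0 -> x \is a GRing.unit.

Definition cluster_var s (i : 'I_n) : F := frame s (evec i).

Definition frame_free s : Prop :=
  forall (es : seq 'rV[int]_n) (c : 'rV[int]_n -> Zq), uniq es ->
    \sum_(e <- es) c e *: frame s e = 0 -> forall e, e \in es -> c e = 0.

Definition in_torus s (x : F) : Prop :=
  exists (es : seq 'rV[int]_n) (c : 'rV[int]_n -> Zq),
    x = \sum_(e <- es) c e *: frame s e.

(* The last three fields say that the span of the X^e is the quantum torus of
   Lambda, with basis the X^e, and that the skew field F is its skew field of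
   (right) fractions. *)
Record is_quantum_seed d s : Prop := IsQuantumSeed {
  qseed_pos : forall i, 0 < d 0 i;
  qseed_skewB : (diag_mx d *m exmx s)^T = - (diag_mx d *m exmx s);
  qseed_skewL : (qcmx s)^T = - qcmx s;
  qseed_compat : (exmx s)^T *m qcmx s = diag_mx d;
  qseed_mul : forall e f : 'rV[int]_n,
    frame s e * frame s f
      = qhalf ((e *m qcmx s *m f^T) 0 0) *: frame s (e + f);
  qseed_free : frame_free s;
  qseed_frac : forall x : F, exists a b,
    [/\ in_torus s a, in_torus s b, b != 0 & x = a / b]
}.

Definition mut_exmx (k : 'I_n) (B : 'M[int]_n) : 'M[int]_n :=
  \matrix_(i, j) if (i == k) || (j == k) then - B i j
                 else B i j + Num.sg (B i k) * pospart (B i k * B k j).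

Definition mut_qcmx (k : 'I_n) (B L : 'M[int]_n) : 'M[int]_n :=
  \matrix_(i, j)
    if (i == k) && (j != k) then
      - L k j + \sum_(l < n) pospart (B l k) * L l j
    else if (i != k) && (j == k) then
      - L i k + \sum_(l < n) pospart (B l k) * L i l
    else L i j.

Definition mut_var (k : 'I_n) s : F :=
  frame s (- evec k + \row_i pospart (exmx s i k))
  + frame s (- evec k + \row_i pospart (- exmx s i k)).

(* The frame of a quantum seed is determined by its cluster variables and
   Lambda, so it is enough to prescribe the cluster variables of s'. *)
Record mutation (k : 'I_n) s s' : Prop := Mutation {
  mutation_var : forall i,
    cluster_var s' i = if i == k then mut_var k s else cluster_var s i;
  mutation_exmx : exmx s' = mut_exmx k (exmx s);
  mutation_qcmx : qcmx s' = mut_qcmx k (exmx s) (qcmx s)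
}.

Record quantum_seed_pattern d (S : tree n -> seed n F) : Prop :=
  QuantumSeedPattern {
  pattern_seed : forall t, is_quantum_seed d (S t);
  pattern_mut : forall k t t', tree_edge k t t' -> mutation k (S t) (S t')
}.

Definition is_cluster_var (S : tree n -> seed n F) (x : F) : Prop :=
  exists t i, x = cluster_var (S t) i.

Definition quantum_cluster_algebra (S : tree n -> seed n F) : algType Zq :=
  subalg (is_cluster_var S).

End QuantumSeeds.

(* Main.v *)
(* Expanding {ac, bd} in two ways gives {a,b} x [c,d] = [a,b] x {c,d}, so in the
   skew field F the bracket is l [-,-] with l central, and the center of F is
   the fraction field of the ground ring k because Lambda is nondegenerate. For
   an inner bracket, A_q contains a' = l X_1 + y with y central, and it remains
   to see that l has no denominator.

   Give X^e the weight prod_i p_i^(e_i), for distinct primes p_i. Taking the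
   largest weight in the support is a multiplicative ultrametric norm on the
   torus of the initial seed, which extends to F. The elements of F that are
   limits of torus elements form a subring, and by the geometric series the sum
   of two units of this subring with distinct norms is again a unit. By induction
   along the tree, all X_t^e are units of this subring and their norms depend
   injectively on e, so that the two terms of an exchange relation have distinct
   norms. Hence A_q lies in this subring, and l is the coefficient of X_1 in a
   torus element close to a'. *)

Require Import Defs.
From HB Require Import structures.
From mathcomp Require Import all_boot all_order all_algebra boolp.
From mathcomp Require Import zify lra.

Set Implicit Arguments.
Unset Strict Implicit.
Unset Printing Implicit Defensive.

Import Order.TTheory GRing.Theory Num.Theory.
Local Open Scope ring_scope.

(** * Ground ring: cancellation and powers of q^(1/2) *)

Lemma Zq_mul_neq0 (a b : Zq) : a != 0 -> b != 0 -> a * b != 0.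
Proof. by rewrite -!(inj_eq val_inj) rmorphM !rmorph0 => *; rewrite mulf_neq0. Qed.

Lemma Zq_mulI (a b c : Zq) : a != 0 -> a * b = a * c -> b = c.
Proof.
move=> a0 /eqP; rewrite -subr_eq0 -mulrBr => e; apply/eqP; rewrite -subr_eq0.
by apply: contraLR e => /(Zq_mul_neq0 a0).
Qed.

Lemma qhalfD (m l : int) : qhalf (m + l) = qhalf m * qhalf l.
Proof. by apply: val_inj; rewrite rmorphM /= expfzDr ?xfrac_neq0. Qed.

Lemma qhalf0 : qhalf 0 = 1.
Proof. by apply: val_inj; rewrite rmorph1. Qed.

Lemma qhalf_mulN (m : int) : qhalf m * qhalf (- m) = 1.
Proof. by rewrite -qhalfD subrr qhalf0. Qed.

Lemma qhalf_neq0 (m : int) : qhalf m != 0.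
Proof.
apply: contraNneq (oner_neq0 Zq) => m0.
by rewrite -(qhalf_mulN m) m0 mul0r.
Qed.

(** For a nonnegative exponent, compare the degrees of two polynomials; a negative one is first
    inverted. *)
Lemma qhalf_eq1 (m : int) : qhalf m = 1 -> m = 0.
Proof.
suff pos (l : nat) : qhalf l = 1 -> l = 0%N.
  case: m => l; first by move/pos ->.
  rewrite NegzE => h; have := qhalf_mulN l.+1; rewrite h mulr1.
  by move/pos.
move/(congr1 val); rewrite rmorph1 /= -exprnP /xfrac -tofracXn -tofrac1.
move/eqP; rewrite tofrac_eq => /eqP /(congr1 (fun p : {poly int} => size p)).
by rewrite size_polyXn size_poly1 => -[].
Qed.

Lemma qhalf_inj : injective qhalf.
Proof.
move=> m l e; apply/eqP; rewrite -subr_eq0; apply/eqP/qhalf_eq1.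
by rewrite qhalfD e qhalf_mulN.
Qed.

(** * Weights of exponent vectors by distinct primes *)

Fixpoint ith_prime (i : nat) : nat :=
  if i is j.+1 then s2val (prime_above (ith_prime j)) else 2.

Lemma prime_ith_prime i : prime (ith_prime i).
Proof. by case: i => //= i; case: prime_above. Qed.

Lemma ith_prime_inj : injective ith_prime.
Proof.
apply: incn_inj; apply: leq_mono; apply: (homo_ltn ltn_trans) => i /=.
by case: prime_above.
Qed.

Section Weight.
Variable n : nat.
Implicit Types e f : 'rV[int]_n.

Definition prime_weight e : rat := \prod_(i < n) (ith_prime i)%:R ^ e 0 i.

Lemma ith_prime_neq0 i : (ith_prime i)%:R != 0 :> rat.
Proof. by rewrite pnatr_eq0 -lt0n prime_gt0 ?prime_ith_prime. Qed.

Lemma prime_weight_gt0 e : 0 < prime_weight e.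
Proof.
apply: prodr_gt0 => i _; rewrite exprz_gt0 // ltr0n prime_gt0 //.
exact: prime_ith_prime.
Qed.

Lemma prime_weightD e f : prime_weight (e + f) = prime_weight e * prime_weight f.
Proof.
rewrite -big_split; apply: eq_bigr => i _.
by rewrite mxE expfzDr ?ith_prime_neq0.
Qed.

(** Unique factorization: with the negative exponents moved to the other side, two products of prime
    powers agree, and [logn] compares them prime by prime. *)
Lemma prime_weight_eq1 e : prime_weight e = 1 -> e = 0.
Proof.
pose P (g : 'I_n -> nat) := (\prod_(i < n) ith_prime i ^ g i)%N.
have Pgt0 g : (0 < P g)%N.
  by rewrite prodn_gt0 // => i; rewrite expn_gt0 prime_gt0 ?prime_ith_prime.
have lognP g (j : 'I_n) : logn (ith_prime j) (P g) = g j.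
  have [_ ->] : (0 < P g)%N /\
      logn (ith_prime j) (P g) = (\sum_(i < n) logn (ith_prime j) (ith_prime i ^ g i))%N.
    (* Positivity is carried along because [lognM] asks for positive factors. *)
    apply: (big_ind2 (fun x y => (0 < x)%N /\ logn (ith_prime j) x = y)).
    - by rewrite logn1.
    - by move=> x _ y _ [x0 <-] [y0 <-]; rewrite muln_gt0 x0 lognM.
    - by move=> i _; rewrite expn_gt0 prime_gt0 ?prime_ith_prime.
  rewrite (bigD1 j) //= lognX logn_prime ?prime_ith_prime // eqxx muln1.
  rewrite big1 ?addn0 // => i ij; rewrite lognX logn_prime ?prime_ith_prime //.
  by rewrite (inj_eq ith_prime_inj) (inj_eq val_inj) eq_sym (negbTE ij) muln0.
pose gp i := if e 0 i is Posz m then m else 0%N.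
pose gn i := if e 0 i is Negz m then m.+1 else 0%N.
move=> e1.
have Pe : P gp = P gn.
  apply/eqP; rewrite -(eqr_nat rat) -[(P gn)%:R]mul1r -[X in X * _]e1 /P.
  rewrite !natr_prod -big_split.
  apply/eqP/eq_bigr => i _; rewrite !natrX /gp /gn.
  case: (e 0 i) => m /=; first by rewrite expr0 mulr1.
  by rewrite expr0 mulVf ?expf_neq0 ?ith_prime_neq0.
apply/rowP=> i; rewrite mxE.
have := lognP gp i; rewrite Pe lognP /gp /gn.
by case: (e 0 i) => m //= <-.
Qed.
End Weight.

(** * Identities in a noncommutative Poisson algebra *)

Section Poisson.
Variables (R : comNzRingType) (A : algType R) (br : A -> A -> A).
Hypothesis hbr : is_poisson br.

Lemma poissonDr a b c : br a (b + c) = br a b + br a c.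
Proof. by rewrite -[b]scale1r (poisson_linearr hbr) !scale1r. Qed.

Lemma poissonDl a b c : br (a + b) c = br a c + br b c.
Proof.
by have := poisson_linearl hbr c 1 a b; rewrite !scale1r.
Qed.

Lemma poissonC a b : br a b = - br b a.
Proof.
have := poisson_alt hbr (a + b); rewrite poissonDr !poissonDl !(poisson_alt hbr).
by rewrite add0r addr0 addrC => /eqP; rewrite addr_eq0 => /eqP.
Qed.

Lemma poisson_leibnizl a b c : br (a * b) c = a * br b c + br a c * b.
Proof.
by rewrite poissonC (poisson_leibniz hbr) opprD (poissonC c a) (poissonC c b)
  mulNr mulrN !opprK addrC.
Qed.

(* Expand br (a c) (b d) by the Leibniz rule in both possible orders. *)
Lemma poisson_commutator a b c d :
  br a b * commutator c d = commutator a b * br c d.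
Proof.
rewrite /commutator mulrBr mulrBl !mulrA.
have := poisson_leibnizl a c (b * d).
rewrite (poisson_leibniz hbr) !poisson_leibnizl !(poisson_leibniz hbr).
rewrite !mulrDl !mulrDr !mulrA -!addrA => /addrI e.
apply/eqP; rewrite subr_eq addrAC eq_sym subr_eq eq_sym.
by apply/eqP/(@addIr _ (b * br a d * c)); rewrite -!addrA.
Qed.

(** Put x c in place of c in [poisson_commutator]; the terms that end in c cancel by the same
    identity. The free factor x later forces the ratio of bracket and commutator to be central. *)
Lemma poisson_commutator_mid a b c d x :
  br a b * x * commutator c d = commutator a b * x * br c d.
Proof.
have comM y z w : commutator (y * z) w = y * commutator z w + commutator y w * z.
  by rewrite /commutator mulrBr mulrBl !mulrA addrA subrK.
have := poisson_commutator a b (x * c) d.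
rewrite comM poisson_leibnizl !mulrDr !mulrA poisson_commutator.
by move/addIr.
Qed.

End Poisson.

(* Otherwise [//] may try to compute in the fraction field of Z[x]. *)
Local Opaque qhalf.

(** * The quantum torus and the center of its skew field *)

Section QuantumTorus.
Variables (n : nat) (F : unitAlgType Zq) (hF : skew_field F).
Variables (d : 'rV[int]_n) (s : seed n F) (hs : is_quantum_seed d s).
Implicit Types (e f : 'rV[int]_n) (c : Zq) (x y z : F).

Local Notation X := (frame s).
Local Notation form e f := ((e *m qcmx s *m f^T) 0 0).

Lemma frame_eq0 c e : c *: X e = 0 -> c = 0.
Proof.
move=> h; have free : frame_free s := qseed_free hs.
by apply: (free [:: e] (fun=> c)); rewrite ?inE ?big_seq1.
Qed.

Lemma frame_neq0 e : X e != 0.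
Proof.
apply: contraNneq (oner_neq0 Zq) => Xe.
by apply/eqP/(@frame_eq0 _ e); rewrite scale1r.
Qed.

Lemma frame0 : X 0 = 1.
Proof.
have := qseed_mul hs 0 0; rewrite !mul0mx mxE qhalf0 scale1r addr0.
by move/(canRL (mulrK (hF (frame_neq0 0)))); rewrite divrr // hF // frame_neq0.
Qed.

Lemma formDl e e' f : form (e + e') f = form e f + form e' f.
Proof. by rewrite !mulmxDl [LHS]mxE. Qed.

Lemma formNr e f : form e (- f) = - form e f.
Proof. by rewrite linearN mulmxN [LHS]mxE. Qed.

Lemma form_skew e f : form e f = - form f e.
Proof.
have -> : form e f = (e *m qcmx s *m f^T)^T 0 0 by rewrite [RHS]mxE.
by rewrite !trmx_mul trmxK (qseed_skewL hs) mulNmx mulmxN mulmxA [LHS]mxE.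
Qed.

Lemma formDr e f f' : form e (f + f') = form e f + form e f'.
Proof. by rewrite [LHS]form_skew formDl opprD -!form_skew. Qed.

Lemma form_alt e : form e e = 0.
Proof. by have := form_skew e e; lia. Qed.

(** By compatibility, pairing the i-th column of B with e gives d_i e_i. *)
Lemma form_neq0 e : e != 0 -> exists f, form f e != 0.
Proof.
move=> e0; have /existsP[i ei] : [exists i, e 0 i != 0].
  apply: contraNT e0; rewrite negb_exists => /forallP h.
  by apply/eqP/rowP => i; rewrite mxE; apply/eqP; have := h i; rewrite negbK.
exists (row i (exmx s)^T); rewrite -row_mul (qseed_compat hs) row_diag_mx.
rewrite -scalemxAl mxE -rowE mxE mxE mulf_neq0 //.
by rewrite gt_eqF // (qseed_pos hs).
Qed.

Lemma frame_mulN e : X e * X (- e) = 1.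
Proof. by rewrite (qseed_mul hs) formNr form_alt oppr0 qhalf0 scale1r subrr frame0. Qed.

Lemma frame_opp e : X (- e) = (X e)^-1.
Proof.
apply: (mulrI (hF (frame_neq0 e))).
by rewrite frame_mulN divrr // hF // frame_neq0.
Qed.

Lemma frame_conj f e : X f * X e * X (- f) = qhalf (form f e *+ 2) *: X e.
Proof.
rewrite (qseed_mul hs) -scalerAl (qseed_mul hs) scalerA -qhalfD addrAC subrr add0r.
by rewrite formNr formDl form_alt add0r -form_skew mulr2n.
Qed.

Lemma scalar_neq0 c : c != 0 -> c%:A != 0 :> F.
Proof. by apply: contraNneq => h; apply/eqP/(@frame_eq0 _ 0); rewrite frame0. Qed.

Lemma skew_mul_neq0 x y : x != 0 -> y != 0 -> x * y != 0.
Proof.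
move=> /hF ux /hF uy; have: x * y \is a GRing.unit by rewrite unitrMl.
by apply: contraTneq => ->; rewrite unitr0.
Qed.

Lemma skew_scaleI c x y : c != 0 -> c *: x = c *: y -> x = y.
Proof.
move=> c0 h; apply: (mulrI (hF (scalar_neq0 c0))).
by rewrite -!scalerAl !mul1r.
Qed.

(** Exponents may repeat, so closure under sums and products is a direct induction; [tspanP]
    recovers distinct exponents. *)
Inductive tspan (P : 'rV[int]_n -> Prop) : F -> Prop :=
| tspan0 : tspan P 0
| tspan_cons c e x : P e -> tspan P x -> tspan P (c *: X e + x).

Lemma tspan_frame P c e : P e -> tspan P (c *: X e).
Proof. by move=> Pe; rewrite -[_ *: _]addr0; apply: tspan_cons => //; apply: tspan0. Qed.

Lemma tspan_sub P Q x : (forall e, P e -> Q e) -> tspan P x -> tspan Q x.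
Proof.
move=> PQ; elim=> [|c e y Pe _ IH]; first exact: tspan0.
by apply: tspan_cons => //; apply: PQ.
Qed.

Lemma tspanD P x y : tspan P x -> tspan P y -> tspan P (x + y).
Proof.
move=> h hy; elim: h => [|c e z Pe _ IH]; first by rewrite add0r.
by rewrite -addrA; apply: tspan_cons.
Qed.

Lemma tspanZ P c x : tspan P x -> tspan P (c *: x).
Proof.
elim=> [|a e z Pe _ IH]; first by rewrite scaler0; apply: tspan0.
by rewrite scalerDr scalerA; apply: tspan_cons.
Qed.

Lemma tspanN P x : tspan P x -> tspan P (- x).
Proof. by rewrite -scaleN1r; apply: tspanZ. Qed.

Lemma tspanM P Q U x y : (forall e f, P e -> Q f -> U (e + f)) ->
  tspan P x -> tspan Q y -> tspan U (x * y).
Proof.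
move=> PQU hx hy; elim: hx => [|c e z Pe _ IH].
  by rewrite mul0r; apply: tspan0.
rewrite mulrDl; apply: tspanD => {IH} //.
elim: hy => [|a f w Qf _ IH]; first by rewrite mulr0; apply: tspan0.
rewrite mulrDr; apply: tspanD => //.
rewrite -scalerAl -scalerAr (qseed_mul hs) !scalerA.
exact/tspan_frame/PQU.
Qed.

Lemma tspanP P x : tspan P x -> exists (es : seq 'rV[int]_n) (a : 'rV[int]_n -> Zq),
  [/\ uniq es, forall e, e \in es -> P e & x = \sum_(e <- es) a e *: X e].
Proof.
elim=> [|c e y Pe _ [es [a [ues hes ->]]]].
  by exists [::], (fun=> 0); rewrite big_nil.
have [ees|ees] := boolP (e \in es).
  exists es, (fun f => a f + (if f == e then c else 0)); split=> //.
  under [RHS]eq_bigr do rewrite scalerDl.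
  rewrite big_split /= [RHS]addrC (bigD1_seq e) //=; congr (_ + _).
  rewrite [in RHS](bigD1_seq e) //= eqxx big1 ?addr0 // => f /negbTE ->.
  by rewrite scale0r.
exists (e :: es), (fun f => if f == e then c else a f); split=> //=.
- by rewrite ees.
- by move=> f; rewrite inE => /predU1P[->|/hes].
- rewrite big_cons eqxx; congr (_ + _).
  rewrite !big_seq; apply: eq_bigr => f fes.
  by case: eqP fes ees => // -> ->.
Qed.

(** If e is absent from the expansion, subtracting the two sides gives a relation between distinct
    exponents, and freeness applies. *)
Lemma tspan_coef P c e : tspan P (c *: X e) -> c = 0 \/ P e.
Proof.
move=> /tspanP[es [a [ues hes xE]]].
have [/hes ?|ees] := boolP (e \in es); [by right|left].
have free : frame_free s := qseed_free hs.
have := free (e :: es) (fun f => if f == e then c else - a f).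
move=> /(_ _ _ e); rewrite inE eqxx; apply => //=; first by rewrite ees.
rewrite big_cons eqxx {1}xE !big_seq -big_split big1 // => f fes /=.
by case: eqP fes ees => [-> -> //|_ _ _]; rewrite scaleNr subrr.
Qed.

Lemma tspan_split e P x : tspan P x ->
  exists c y, x = c *: X e + y /\ tspan (fun f => f <> e /\ P f) y.
Proof.
elim=> [|c f y Pf _ [a [z [-> hz]]]].
  by exists 0, 0; rewrite scale0r addr0; split=> //; apply: tspan0.
have [->|/eqP fe] := eqVneq f e.
  by exists (c + a), z; rewrite scalerDl addrA.
by exists a, (c *: X f + z); rewrite addrCA; split=> //; apply: tspan_cons.
Qed.

Definition torus := tspan (fun=> True).

Lemma torus_frame e : torus (X e).
Proof. by rewrite -[X e]scale1r; apply: tspan_frame. Qed.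

Lemma in_torusP x : in_torus s x -> torus x.
Proof.
case=> es [a ->]; elim/big_ind: _ => [|y z|e _]; first exact: tspan0.
  exact: tspanD.
exact: tspan_frame.
Qed.

Lemma torusM x y : torus x -> torus y -> torus (x * y).
Proof. exact: tspanM. Qed.

Lemma torus_scalar c : torus c%:A.
Proof. by rewrite -frame0; apply: tspan_frame. Qed.

Lemma torus_fracP x : exists a b, [/\ torus a, torus b, b != 0 & x * b = a].
Proof.
have [a [b [/in_torusP ha /in_torusP hb b0 ->]]] := qseed_frac hs x.
by exists a, b; split; rewrite // divrK // hF.
Qed.

(** The right Ore condition, read off from x^-1 y written as a fraction. *)
Lemma torus_ore x y : torus y -> x != 0 ->
  exists u v, [/\ torus u, torus v, v != 0 & x * u = y * v].
Proof.
move=> hy x0; have [u [v [hu hv v0 e]]] := torus_fracP (x^-1 * y).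
exists u, v; split=> //.
by rewrite -e !mulrA divrr ?mul1r // hF.
Qed.

(* Conjugation by the X^f acts on the basis X^e by characters, and distinct e
   give distinct characters. *)
Lemma torus_isolate (J : F -> Prop) (es : seq 'rV[int]_n)
      (a : 'rV[int]_n -> Zq) c e :
    (forall x y, J x -> J y -> J (x - y)) ->
    (forall c x, J x -> J (c *: x)) ->
    (forall f x, J x -> J (X f * x * X (- f))) ->
    e \notin es -> c != 0 -> J (c *: X e + \sum_(f <- es) a f *: X f) ->
  exists2 c', c' != 0 & J (c' *: X e).
Proof.
move=> JB JZ JX; elim: es a c => [|g es IH] a c.
  by move=> _ c0; rewrite big_nil addr0; exists c.
rewrite inE negb_or => /andP[eg ees] c0 hJ.
have [f hf] : exists f, form f (e - g) != 0 by apply: form_neq0; rewrite subr_eq0.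
pose b h := a h * (qhalf (form f h *+ 2) - qhalf (form f g *+ 2)).
pose c' := c * (qhalf (form f e *+ 2) - qhalf (form f g *+ 2)).
apply: (IH b c' ees).
  apply: (Zq_mul_neq0 c0); rewrite subr_eq0 (inj_eq qhalf_inj).
  by apply: contraNneq hf => h; rewrite formDr formNr; lia.
have := JB _ _ (JX f _ hJ) (JZ (qhalf (form f g *+ 2)) _ hJ).
congr J; rewrite big_cons !mulrDr !mulrDl !scalerDr.
have conjE (h : 'rV[int]_n) (r : Zq) :
    X f * (r *: X h) * X (- f) = (r * qhalf (form f h *+ 2)) *: X h.
  by rewrite -scalerAr -scalerAl frame_conj scalerA.
rewrite !conjE !scalerA mulr_sumr mulr_suml scaler_sumr.
rewrite opprD addrACA opprD [X in _ + X]addrACA.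
rewrite [_ * a g]mulrC subrr add0r -sumrB -scalerBl [_ * c]mulrC -mulrBr.
congr (_ + _); apply: eq_bigr => h _.
by rewrite conjE scalerA -scalerBl [_ * a h]mulrC -mulrBr.
Qed.

Lemma torus_neq0P P x : tspan P x -> x != 0 -> exists es a c e,
  [/\ e \notin es, c != 0, P e & x = c *: X e + \sum_(f <- es) a f *: X f].
Proof.
move=> /tspanP[es [a [ues hes xE]]] x0.
have /hasP[e ees ae] : has (fun e => a e != 0) es.
  apply: contraNT x0 => /hasPn h; rewrite xE big_seq big1 // => e /h.
  by rewrite negbK => /eqP ->; rewrite scale0r.
exists [seq f <- es | f != e], a, (a e), e.
rewrite mem_filter eqxx big_filter; split=> //; first exact: hes.
by rewrite xE (bigD1_seq e).
Qed.

(** The denominators of a central z are stable under conjugation by monomials, so some monomial is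
    one and a multiple r z lies in the torus. Its nonconstant part is central and must vanish by
    nondegeneracy. *)
Lemma central_frac z : (forall e, GRing.comm z (X e)) ->
  exists r p : Zq, r != 0 /\ r *: z = p%:A.
Proof.
move=> zX; have [a [b [ha hb b0 zb]]] := torus_fracP z.
have [es [g [c [e [ees c0 _ bE]]]]] := torus_neq0P hb b0.
have [||||r r0 [_ hr]] := @torus_isolate (fun x => torus x /\ torus (z * x))
  es g c e _ _ _ ees c0.
- by move=> x y [? ?] [? ?]; rewrite mulrBr; split; apply: tspanD => //; apply: tspanN.
- by move=> k x [? ?]; rewrite -scalerAr; split; apply: tspanZ.
- move=> f x [? ?]; have -> : z * (X f * x * X (- f)) = X f * (z * x) * X (- f).
    by rewrite !mulrA zX.
  have hX g : torus (X g) := torus_frame g.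
  by split; apply: torusM => //; apply: torusM.
- by rewrite -bE zb.
have hw : torus (r *: z).
  have -> : r *: z = z * (r *: X e) * X (- e).
    by rewrite -scalerAr -scalerAl -mulrA frame_mulN mulr1.
  by apply: torusM => //; apply: torus_frame.
have [p [y [wE hy]]] := tspan_split 0 hw.
exists r, p; split=> //; rewrite wE frame0.
have [->|y0] := eqVneq y 0; first by rewrite addr0.
have yX f : GRing.comm y (X f).
  have -> : y = r *: z - p%:A by rewrite wE frame0 addrC addKr.
  by rewrite /GRing.comm mulrBl mulrBr -!scalerAl -!scalerAr zX mul1r mulr1.
(* A nonzero y would yield, by isolation among central elements without constant term, a central
   monomial of nonzero exponent. *)
have [es' [g' [c' [e' [ees' c0' _ yE]]]]] := torus_neq0P hy y0.
have [||||r' r0' [hr' cr']] := @torus_isolate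
  (fun x => tspan (fun f => f <> 0 /\ True) x /\ forall f, GRing.comm x (X f))
  es' g' c' e' _ _ _ ees' c0'.
- move=> x x' [? h] [? h']; split; first by apply: tspanD => //; apply: tspanN.
  by move=> f; apply/commr_sym/commrB; apply: commr_sym.
- move=> k x [? h]; split; first exact: tspanZ.
  by move=> f; rewrite /GRing.comm -scalerAl -scalerAr h.
- by move=> f x [? h]; rewrite -h -mulrA frame_mulN mulr1.
- by rewrite -yE.
case: (tspan_coef hr') => [r'0|[/eqP e'0 _]]; first by rewrite r'0 eqxx in r0'.
have [f /eqP []] := form_neq0 e'0.
have : X f * (r' *: X e') * X (- f) = r' *: X e' by rewrite -cr' -mulrA frame_mulN mulr1.
rewrite -scalerAr -scalerAl frame_conj scalerA => /eqP.
rewrite -subr_eq0 -scalerBl -{2}[r']mulr1 -mulrBr => /eqP/frame_eq0/eqP.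
apply: contraTeq => fe; apply: (Zq_mul_neq0 r0').
by rewrite subr_eq0 -qhalf0 (inj_eq qhalf_inj) mulrn_eq0.
Qed.

End QuantumTorus.

(** * Rational estimates and multiplicative weights *)

Lemma expr_lt_eps (r eps : rat) : 0 <= r < 1 -> 0 < eps -> exists m, r ^+ m < eps.
Proof.
move=> /andP[r0 r1] e0.
have [->|rn0] := eqVneq r 0; first by exists 1%N; rewrite expr1.
have {rn0}r0 : 0 < r by rewrite lt_def rn0.
pose t := r^-1 - 1.
have t0 : 0 < t by rewrite subr_gt0 invf_gt1.
(* Bernoulli's inequality for r^-1 = 1 + t. *)
have bern m : 1 + m%:R * t <= r^-1 ^+ m.
  elim: m => [|m IH]; first by rewrite mul0r addr0 expr0.
  have -> : r^-1 ^+ m.+1 = (t + 1) * r^-1 ^+ m by rewrite /t subrK exprS.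
  rewrite -natr1.
  have mt : 0 <= m%:R * t * t by rewrite !mulr_ge0 ?ler0n // ltW.
  have t1 : 0 <= t + 1 by rewrite addr_ge0 // ltW.
  have := ler_wpM2l t1 IH; lra.
have u0 : 0 <= (eps * t)^-1 by rewrite invr_ge0 mulr_ge0 // ltW.
exists (Num.bound (eps * t)^-1).
have := archi_boundP u0; set m := Num.bound _ => hm.
rewrite -[r]invrK exprVn invf_plt ?posrE ?exprn_gt0 ?invr_gt0 //.
apply: lt_le_trans (bern m); rewrite -(ltr_pM2r t0) in hm.
have : eps^-1 = (eps * t)^-1 * t by rewrite invfM mulrVK // unitfE gt_eqF.
lra.
Qed.

Section Weights.
Variables (n : nat) (w : 'rV[int]_n -> rat).
Hypothesis w_gt0 : forall e, 0 < w e.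
Hypothesis wD : forall e f, w (e + f) = w e * w f.

Lemma weight0 : w 0 = 1.
Proof.
have := wD 0 0; rewrite addr0 => h.
by apply/esym/(mulfI (lt0r_neq0 (w_gt0 0))); rewrite -h mulr1.
Qed.

Lemma weightN e : w (- e) = (w e)^-1.
Proof.
apply: (mulfI (lt0r_neq0 (w_gt0 e))).
by rewrite -wD subrr weight0 divff ?gt_eqF.
Qed.

End Weights.

(** * The norm on the skew field and the limits of torus elements *)

Section Weighted.
Variables (n : nat) (F : unitAlgType Zq) (hF : skew_field F).
Variables (d : 'rV[int]_n) (s : seed n F) (hs : is_quantum_seed d s).
Variable w : 'rV[int]_n -> rat.
Hypothesis w_gt0 : forall e, 0 < w e.
Hypothesis wD : forall e f, w (e + f) = w e * w f.
Hypothesis w_inj : injective w.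
Implicit Types (e f : 'rV[int]_n) (c : Zq) (x y z : F) (r : rat).

Local Notation X := (frame s).
Local Notation torus := (torus s).

Let weight0 := weight0 w_gt0 wD.

Definition tle r := tspan s (fun f => w f <= r).
Definition tlt r := tspan s (fun f => w f < r).

Lemma tle_mono r r' x : r <= r' -> tle r x -> tle r' x.
Proof. by move=> rr; apply: tspan_sub => e /le_trans; apply. Qed.

Lemma tleM r r' x y : tle r x -> tle r' y -> tle (r * r') (x * y).
Proof. by apply: (tspanM hs) => e f he hf; rewrite wD ler_pM // ltW. Qed.

Lemma tle_bounded x : torus x -> exists2 r, 0 < r & tle r x.
Proof.
elim=> [|c e y _ _ [r r0 h]]; first by exists 1 => //; apply: tspan0.
exists (Num.max r (w e)); first by rewrite lt_max r0.
apply: tspan_cons; first by rewrite le_max lexx orbT.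
by apply: tle_mono h; rewrite le_max lexx.
Qed.

Definition lead x e :=
  exists c y, [/\ c != 0, tlt (w e) y & x = c *: X e + y].

Lemma lead_torus x e : lead x e -> torus x.
Proof.
move=> [c [y [_ hy ->]]]; apply: tspan_cons => //.
exact: tspan_sub hy.
Qed.

Lemma lead_tle x e : lead x e -> tle (w e) x.
Proof.
move=> [c [y [_ hy ->]]]; apply: tspan_cons => //.
by apply: tspan_sub hy => f /ltW.
Qed.

(** Otherwise the leading monomial would lie in the span of strictly lighter ones. Hence the leading
    weight depends on x only: it is the norm of x. *)
Lemma lead_weight_le x e r : lead x e -> tle r x -> w e <= r.
Proof.
move=> [c [y [c0 hy ->]]] h; rewrite leNgt; apply/negP => hr.
have : tlt (w e) (c *: X e).
  rewrite -[_ *: _](addrK y); apply: tspanD; last exact: tspanN.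
  by apply: tspan_sub h => f /le_lt_trans; apply.
move=> /(tspan_coef hs)[c00|]; first by rewrite c00 eqxx in c0.
by rewrite ltxx.
Qed.

Lemma lead_neq0 x e : lead x e -> x != 0.
Proof.
move=> h; apply/eqP => x0; have := w_gt0 e; rewrite ltNge => /negP; apply.
by apply: lead_weight_le h _; rewrite x0; apply: tspan0.
Qed.

(** The norm is multiplicative on the torus: the product of the leading terms outweighs all others,
    and its coefficient is nonzero in the domain [Zq]. *)
Lemma leadM x y e f : lead x e -> lead y f -> lead (x * y) (e + f).
Proof.
move=> [c [x' [c0 hx ->]]] [a [y' [a0 hy ->]]].
exists (c * a * qhalf ((e *m qcmx s *m f^T) 0 0)).
exists (c *: X e * y' + x' * (a *: X f + y')); split.
- exact: Zq_mul_neq0 (Zq_mul_neq0 c0 a0) (qhalf_neq0 _).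
- apply: tspanD.
    apply: (tspanM hs (P := fun g => g = e)) hy; last exact: tspan_frame.
    by move=> g h -> hh; rewrite !wD ltr_pM2l.
  apply: (tspanM hs (Q := fun g => w g <= w f)) hx _.
    move=> g h gw hw; rewrite !wD; apply: (@le_lt_trans _ _ (w g * w f)).
      by rewrite ler_pM2l.
    by rewrite ltr_pM2r.
  by apply: tspan_cons => //; apply: tspan_sub hy => g /ltW.
- by rewrite mulrDl mulrDr addrA -scalerAl -scalerAr (qseed_mul hs) !scalerA.
Qed.

(** Injectivity of [w] excludes ties between distinct exponents. *)
Lemma lead_exists x : torus x -> x != 0 -> exists e, lead x e.
Proof.
move=> /tspanP[es [a [ues _ ->]]].
suff [->|[e _ h] _] : \sum_(e <- es) a e *: X e = 0 \/
    exists2 e, e \in es & lead (\sum_(e <- es) a e *: X e) e.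
- by rewrite eqxx.
- by exists e.
elim: es ues => [|f es IH] /=; first by left; rewrite big_nil.
move=> /andP[fes /IH{}IH]; rewrite big_cons.
have [->|af] := eqVneq (a f) 0.
  rewrite scale0r add0r; case: IH => [|[e ees h]]; [by left|right].
  by exists e; rewrite ?inE ?ees ?orbT.
right; case: IH => [->|[e ees he]].
  exists f; first by rewrite inE eqxx.
  by exists (a f), 0; split=> //; apply: tspan0.
have [fe|ef|/w_inj fe] := ltgtP (w f) (w e).
- exists e; first by rewrite inE ees orbT.
  move: he => [c [y [c0 hy ->]]]; exists c, (a f *: X f + y); split=> //.
    exact: tspan_cons.
  by rewrite addrCA.
- exists f; first by rewrite inE eqxx.
  exists (a f), (\sum_(e <- es) a e *: X e); split=> //.
  by apply: tspan_sub (lead_tle he) => g /le_lt_trans; apply.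
- by rewrite fe ees in fes.
Qed.

Lemma lead_add x y e r : lead x e -> r < w e -> tle r y -> lead (x + y) e.
Proof.
move=> [c [x' [c0 hx ->]]] re hy; exists c, (x' + y); rewrite addrA; split=> //.
by apply: tspanD => //; apply: tspan_sub hy => f /le_lt_trans; apply.
Qed.

Lemma lead1 : lead 1 0.
Proof.
exists 1, 0; split; rewrite ?oner_neq0 //; first exact: tspan0.
by rewrite addr0 scale1r (frame0 hF hs).
Qed.

(* The norm of x is at most r: some denominator b of x, with leading exponent
   e, gives a numerator of norm at most r w(e). *)
Definition small r x := exists b e, lead b e /\ tle (r * w e) (x * b).

Lemma small_mono r r' x : r <= r' -> small r x -> small r' x.
Proof.
move=> rr [b [e [hb h]]]; exists b, e; split=> //.
by apply: tle_mono h; rewrite ler_pM2r.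
Qed.

Lemma small_tle r x : tle r x -> small r x.
Proof.
move=> h; exists 1, 0; split; first exact: lead1.
by rewrite weight0 !mulr1.
Qed.

(** Leading weights multiply, so the weight of the denominator cancels and the bound reaches the
    leading exponent of x. *)
Lemma tle_small r x : 0 < r -> torus x -> small r x -> tle r x.
Proof.
move=> r0 hx [b [e [hb h]]].
have [->|x0] := eqVneq x 0; first exact: tspan0.
have [f hf] := lead_exists hx x0.
have := lead_weight_le (leadM hf hb) h; rewrite wD ler_pM2r // => fr.
exact: tle_mono (lead_tle hf).
Qed.

Lemma small_bounded x : exists2 r, 0 < r & small r x.
Proof.
have [a [b [ha hb b0 xb]]] := torus_fracP hF hs x.
have [e he] := lead_exists hb b0; have [r r0 h] := tle_bounded ha.
exists (r / w e); first by rewrite divr_gt0.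
by exists b, e; rewrite xb divfK ?gt_eqF.
Qed.

(** The Ore condition gives a common denominator b u = b' v; uniqueness of the leading weight
    identifies w (e + f) with w (e' + g). *)
Lemma smallD r x y : small r x -> small r y -> small r (x + y).
Proof.
move=> [b [e [hb h]]] [b' [e' [hb' h']]].
have b0 := lead_neq0 hb; have b0' := lead_neq0 hb'.
have [u [v [hu hv v0 E]]] := torus_ore hF hs (lead_torus hb') b0.
have u0 : u != 0.
  apply: contraTneq (skew_mul_neq0 hF b0' v0) => u0.
  by rewrite -E u0 mulr0 eqxx.
have [f hf] := lead_exists hu u0; have [g hg] := lead_exists hv v0.
have hbu := leadM hb hf; have hbv := leadM hb' hg.
exists (b * u), (e + f); split=> //.
rewrite mulrDl {2}E !mulrA wD mulrA.
apply: tspanD; first exact: tleM h (lead_tle hf).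
apply: tle_mono (tleM h' (lead_tle hg)).
rewrite -!mulrA -!wD.
have -> // : w (e + f) = w (e' + g).
apply/le_anti/andP; split.
  by apply: lead_weight_le hbu _; rewrite E; apply: lead_tle.
by apply: lead_weight_le hbv _; rewrite -E; apply: lead_tle.
Qed.

(** The Ore condition matches the numerator of y with the denominator of x: b u = y b' v, so b' v is
    a denominator of x y with numerator x b u. *)
Lemma smallM r r' x y : 0 < r -> small r x -> small r' y -> small (r * r') (x * y).
Proof.
move=> r0 [b [e [hb h]]] [b' [e' [hb' h']]].
have b0 := lead_neq0 hb; have b0' := lead_neq0 hb'.
have hyb : torus (y * b') by apply: tspan_sub h'.
have [u [v [hu hv v0 E]]] := torus_ore hF hs hyb b0.
have [g hg] := lead_exists hv v0.
exists (b' * v), (e' + g); split; first exact: leadM.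
have -> : x * y * (b' * v) = x * b * u by rewrite -mulrA [y * _]mulrA -E mulrA.
have [->|u0] := eqVneq u 0; first by rewrite mulr0; apply: tspan0.
have [f hf] := lead_exists hu u0.
apply: tle_mono (tleM h (lead_tle hf)).
have := lead_weight_le (leadM hb hf).
rewrite E => /(_ _ (tleM h' (lead_tle hg))); rewrite !wD => hh.
by rewrite -!mulrA ler_pM2l // mulrA.
Qed.

Lemma small_scalar c : small 1 c%:A.
Proof.
apply: small_tle; rewrite -(frame0 hF hs); apply: tspan_frame.
by rewrite weight0.
Qed.

Lemma smallZ r c x : small r x -> small r (c *: x).
Proof.
move=> h; rewrite -[x]mul1r scalerAl -[r]mul1r; apply: smallM => //.
exact: small_scalar.
Qed.

Lemma smallN r x : small r x -> small r (- x).
Proof. by rewrite -scaleN1r; apply: smallZ. Qed.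

Lemma smallBC r x y : small r (x - y) -> small r (y - x).
Proof. by move=> h; rewrite -opprB; apply: smallN. Qed.

(** For a denominator b of z, the element (1 + z) b has the leading exponent of b, and it is a
    denominator of (1 + z)^-1 with numerator b. *)
Lemma small_inv1 r z : r < 1 -> small r z -> 1 + z != 0 /\ small 1 (1 + z)^-1.
Proof.
move=> r1 [b [e [hb h]]].
have h1 : lead ((1 + z) * b) e.
  by rewrite mulrDl mul1r; apply: lead_add hb _ h; rewrite -[ltRHS]mul1r ltr_pM2r.
have z0 : 1 + z != 0.
  by apply: contraTneq (lead_neq0 h1) => ->; rewrite mul0r eqxx.
split=> //; exists ((1 + z) * b), e; split=> //.
by rewrite mulKr ?hF // mul1r; apply: lead_tle.
Qed.

(* The elements whose expansion in the completed torus has coefficients in the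
   ground ring. *)
Definition integral x := forall eps, 0 < eps -> exists2 a, torus a & small eps (x - a).

Lemma integral_torus x : torus x -> integral x.
Proof.
by move=> hx eps e0; exists x => //; rewrite subrr; apply/small_tle/tspan0.
Qed.

Lemma integral_closed x :
  (forall eps, 0 < eps -> exists2 y, integral y & small eps (x - y)) -> integral x.
Proof.
move=> h eps e0; have [y hy xy] := h _ e0; have [a ha ya] := hy _ e0.
by exists a => //; rewrite -(subrK y x) -addrA; apply: smallD.
Qed.

Lemma integralD x y : integral x -> integral y -> integral (x + y).
Proof.
move=> hx hy eps e0; have [a ha xa] := hx _ e0; have [b hb yb] := hy _ e0.
exists (a + b); first exact: tspanD.
by rewrite opprD addrACA; apply: smallD.
Qed.

Lemma integralM x y : integral x -> integral y -> integral (x * y).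
Proof.
move=> hx hy eps e0.
(* The approximation b of y is chosen first, so that the precision required for x may depend on the
   norm of b. *)
have [r r0 xr] := small_bounded x.
have [|b hb yb] := hy (eps / r); first by rewrite divr_gt0.
have [r' r0' br] := small_bounded b.
have [|a ha xa] := hx (eps / r'); first by rewrite divr_gt0.
exists (a * b); first exact: (torusM hs).
have -> : x * y - a * b = x * (y - b) + (x - a) * b.
  by rewrite mulrBr mulrBl addrA subrK.
apply: smallD.
  by have := smallM r0 xr yb; rewrite mulrCA divff ?gt_eqF ?mulr1.
have := smallM _ xa br; rewrite divfK ?gt_eqF //; apply.
by rewrite divr_gt0.
Qed.

Lemma integral_scalar c : integral c%:A.
Proof. exact/integral_torus/(torus_scalar hF hs). Qed.

Lemma integralZ c x : integral x -> integral (c *: x).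
Proof.
by move=> h; rewrite -[x]mul1r scalerAl; apply: integralM => //; apply: integral_scalar.
Qed.

Lemma integralB x y : integral x -> integral y -> integral (x - y).
Proof. by move=> hx hy; apply: integralD => //; rewrite -scaleN1r; apply: integralZ. Qed.

Lemma integral1 : integral 1.
Proof. by rewrite -[1]scale1r; apply: integral_scalar. Qed.

(* u = (1 + z)^-1 satisfies u = 1 - z u, so an approximation of u to precision
   eps yields one to precision r eps. *)
Lemma integral_inv1 r z : 0 < r < 1 -> small r z -> integral z -> integral (1 + z)^-1.
Proof.
move=> /andP[r0 r1] zr hz; have [z0 u1] := small_inv1 r1 zr.
set u := (1 + z)^-1 in u1 *.
have uE : u = 1 - z * u.
  have : (1 + z) * u = 1 by rewrite divrr ?hF.
  by rewrite mulrDl mul1r => <-; rewrite addrK.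
apply: integral_closed => eps e0.
have [|m rm] := @expr_lt_eps r eps _ e0; first by rewrite ltW.
suff [y hy uy] : exists2 y, integral y & small (r ^+ m) (u - y).
  by exists y => //; apply: small_mono uy; apply: ltW.
elim: m {rm} => [|m [y hy uy]].
  exists 0; first exact/integral_torus/tspan0.
  by rewrite subr0.
exists (1 - z * y); first by apply: integralB (integralM _ _) => //; apply: integral1.
have -> : u - (1 - z * y) = z * (y - u).
  by rewrite {1}uE opprB addrC addrA subrK mulrBr.
by rewrite exprS; apply: smallM => //; apply: smallBC.
Qed.

(** The two bounds together pin the norm of x to r exactly. *)
Record integral_unit r x : Prop := IntegralUnit {
  iu_gt0 : 0 < r;
  iu_neq0 : x != 0;
  iu_int : integral x;
  iu_inv : integral x^-1;
  iu_small : small r x;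
  iu_smallV : small r^-1 x^-1
}.

Lemma integral_unitM r r' x y :
  integral_unit r x -> integral_unit r' y -> integral_unit (r * r') (x * y).
Proof.
case=> r0 x0 hx hxV xr xrV [r0' y0 hy hyV yr yrV]; split.
- exact: mulr_gt0.
- exact: (skew_mul_neq0 hF).
- exact: integralM.
- by rewrite invrM ?hF //; apply: integralM.
- exact: smallM.
- rewrite (invrM (hF x0) (hF y0)) invfM [r^-1 * _]mulrC.
  by apply: smallM; rewrite ?invr_gt0.
Qed.

Lemma integral_unitV r x : integral_unit r x -> integral_unit r^-1 x^-1.
Proof.
case=> r0 x0 hx hxV xr xrV; split; rewrite ?invrK ?invr_gt0 //.
by rewrite invr_neq0.
Qed.

Lemma integral_unit_frame e : integral_unit (w e) (X e).
Proof.
have sm f : small (w f) (X f).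
  by apply: small_tle; rewrite -[X f]scale1r; apply: tspan_frame.
split; rewrite -?(weightN w_gt0 wD) -?(frame_opp hF hs) ?(frame_neq0 hs) //.
- exact/integral_torus/torus_frame.
- exact/integral_torus/torus_frame.
Qed.

Lemma integral_unit1 : integral_unit 1 1.
Proof.
by have := integral_unit_frame 0; rewrite weight0 (frame0 hF hs).
Qed.

Lemma integral_unit_qhalf m : integral_unit 1 (qhalf m)%:A.
Proof.
have sV : (qhalf m)%:A^-1 = (qhalf (- m))%:A :> F.
  apply: (mulrI (hF (scalar_neq0 hF hs (qhalf_neq0 m)))).
  rewrite divrr ?hF ?(scalar_neq0 hF hs) ?qhalf_neq0 //.
  by rewrite -scalerAl mul1r scalerA qhalf_mulN scale1r.
split=> //; rewrite ?invr1 ?sV; rewrite ?(scalar_neq0 hF hs) ?qhalf_neq0 //.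
- exact: integral_scalar.
- exact: integral_scalar.
- exact: small_scalar.
- exact: small_scalar.
Qed.

Lemma integral_unitZ r m x : integral_unit r x -> integral_unit r (qhalf m *: x).
Proof.
move=> h; rewrite -[x]mul1r scalerAl -[r]mul1r; apply: integral_unitM => //.
exact: integral_unit_qhalf.
Qed.

(** Factor out the dominant term: x + y = x (1 + x^-1 y), where x^-1 y has norm below 1, so the
    second factor is a unit of norm 1. *)
Lemma integral_unitD r r' x y : r' < r ->
  integral_unit r x -> integral_unit r' y -> integral_unit r (x + y).
Proof.
move=> rr hx hy; have r0 := iu_gt0 hx; have r0' := iu_gt0 hy.
have ux := hF (iu_neq0 hx).
have [_ _ hz _ zr _] := integral_unitM (integral_unitV hx) hy.
have -> : x + y = x * (1 + x^-1 * y) by rewrite mulrDr mulr1 mulVKr.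
rewrite -[r]mulr1; apply: integral_unitM => //.
have t1 : 0 < r^-1 * r' < 1.
  by rewrite mulr_gt0 ?invr_gt0 // mulrC ltr_pdivrMr // mul1r.
have [z0 uz] := small_inv1 (andP t1).2 zr.
split=> //; rewrite ?invr1 //.
- by apply: integralD => //; apply: integral1.
- exact: integral_inv1 t1 _ _.
- apply: smallD; first exact: iu_small integral_unit1.
  by apply: small_mono zr; case/andP: t1 => _ /ltW.
Qed.

(* c is the coefficient of X^e in a torus element that approximates z X^e + y to
   a precision smaller than the weight of e. *)
Lemma integral_coef z y e (r p r' p' : Zq) : e <> 0 -> r != 0 -> r' != 0 ->
  r *: z = p%:A -> r' *: y = p'%:A -> integral (z * X e + y) ->
  exists c, z = c%:A.
Proof.
move=> e0 r0 r0' zE yE h.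
have [|a ha small_a] := h (w e / 2); first by rewrite divr_gt0.
have [c [b [aE hb]]] := tspan_split e ha.
exists c; apply: (skew_scaleI hF hs r0); rewrite zE scalerA.
congr (_%:A); apply: (Zq_mulI r0'); apply/eqP; rewrite -subr_eq0; apply/eqP.
(* The factor r' r clears both denominators, so that the error is a torus element and its norm
   bounds its exponents. *)
have tz : torus ((r' * r) *: (z * X e + y - a)).
  rewrite !scalerDr; apply: tspanD; last exact/tspanZ/tspanN.
  apply: tspanD; rewrite -scalerA.
    by apply: tspanZ; rewrite scalerAl zE -scalerAl mul1r; apply: tspan_frame.
  by rewrite scalerA mulrC -scalerA yE; apply/tspanZ/(torus_scalar hF hs).
have hw : 0 < w e / 2 by rewrite divr_gt0.
have := tle_small hw tz (smallZ _ small_a).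
have -> : (r' * r) *: (z * X e + y - a) =
    (r' * p - r' * (r * c)) *: X e + ((r * p')%:A - (r' * r) *: b).
  rewrite aE opprD !scalerDr !scalerN scalerBl addrACA; congr (_ + _).
    congr (_ - _); last by rewrite scalerA mulrA.
    by rewrite -!scalerA scalerAl zE -scalerAl mul1r.
  by congr (_ - _); rewrite mulrC -!scalerA yE.
move=> h1.
(* The monomial at e is a combination of other exponents and of exponents too light to be e, so its
   coefficient vanishes. *)
suff : tspan s (fun f => f <> e \/ w f <= w e / 2) ((r' * p - r' * (r * c)) *: X e).
  move=> /(tspan_coef hs)[//|[//|]].
  by rewrite ler_pdivlMr // ger_pMr // => /negP[].
rewrite -[_ *: X e](addrK ((r * p')%:A - (r' * r) *: b)); apply: tspanD.
  by apply: tspan_sub h1 => f; right.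
apply: tspanN; apply: tspanD.
  rewrite -(frame0 hF hs); apply: tspan_frame; left => e00.
  by apply: e0; rewrite e00.
by apply/tspanN/tspanZ; apply: tspan_sub hb => f [? _]; left.
Qed.

End Weighted.

(** * Seeds whose frames consist of integral units, and their mutations *)

Lemma row_int_ind n (P : 'rV[int]_n -> Prop) :
  P 0 -> (forall e f, P e -> P f -> P (e + f)) -> (forall e, P e -> P (- e)) ->
  (forall i, P (evec i)) -> forall e, P e.
Proof.
move=> P0 PD PN Pi e; rewrite (row_sum_delta e); elim/big_ind: _ => // i _.
have PM (m : nat) : P (m%:Z *: evec i).
  elim: m => [|m IH]; first by rewrite scale0r.
  by rewrite intS scalerDl scale1r; apply: PD.
by case: (e 0 i) => m; [apply: PM | rewrite NegzE scaleNr; apply/PN/PM].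
Qed.

Section Seeds.
Variables (n : nat) (F : unitAlgType Zq) (hF : skew_field F) (d : 'rV[int]_n).
Implicit Types (s : seed n F) (e f : 'rV[int]_n).

Lemma exmx_diag0 s k : is_quantum_seed d s -> exmx s k k = 0.
Proof.
move=> hs; have := congr1 (fun M : 'M[int]_n => M k k) (qseed_skewB hs).
rewrite mxE [RHS]mxE mul_diag_mx mxE => /esym/eqP.
by rewrite eqNr mulf_eq0 gt_eqF ?(qseed_pos hs) //= => /eqP.
Qed.

(** Equality would make the k-th column of B zero, against the diagonal entry d_k > 0 of the
    compatibility relation. *)
Lemma mut_exponents_neq s k : is_quantum_seed d s ->
  - evec k + \row_i pospart (exmx s i k) <> - evec k + \row_i pospart (- exmx s i k).
Proof.
move=> hs /addrI/rowP h.
have B0 i : exmx s i k = 0.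
  by have := h i; rewrite !mxE /pospart; lia.
have := congr1 (fun M : 'M[int]_n => M k k) (qseed_compat hs).
rewrite mxE big1 => [|i _]; last by rewrite mxE B0 mul0r.
by rewrite mxE eqxx mulr1n => h0; have := qseed_pos hs k; rewrite -h0 ltxx.
Qed.

Record is_weight (w : 'rV[int]_n -> rat) : Prop := IsWeight {
  weight_gt0 : forall e, 0 < w e;
  weightD : forall e f, w (e + f) = w e * w f;
  weight_inj : injective w
}.

Lemma prime_weight_is_weight : is_weight (@prime_weight n).
Proof.
split; [exact: prime_weight_gt0 | exact: prime_weightD|].
move=> e f ef; apply/eqP; rewrite -subr_eq0; apply/eqP/prime_weight_eq1.
apply: (mulIf (lt0r_neq0 (prime_weight_gt0 f))).
by rewrite -prime_weightD subrK mul1r.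
Qed.

Variables (s0 : seed n F) (hs0 : is_quantum_seed d s0).
Variable w0 : 'rV[int]_n -> rat.
Hypothesis hw0 : is_weight w0.

Local Notation iunit := (integral_unit s0 w0).

Definition integral_frame s w := forall e, iunit (w e) (frame s e).

(** Up to powers of q^(1/2), which are units of norm 1, every X^e is a product of cluster variables
    and their inverses. *)
Lemma integral_frame_gen s w : is_quantum_seed d s -> is_weight w ->
  (forall i, iunit (w (evec i)) (cluster_var s i)) -> integral_frame s w.
Proof.
case: hw0 => w00 w0D w0I hs [wp wD wI] hi.
apply: row_int_ind => // [|e f he hf|e].
- by rewrite (weight0 wp wD) (frame0 hF hs); apply: (integral_unit1 hF hs0).
- have := integral_unitM hF hs0 w00 w0D w0I he hf; rewrite wD (qseed_mul hs).
  move=> /(integral_unitZ hF hs0 w00 w0D w0I (- (e *m qcmx s *m f^T) 0 0)).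
  by rewrite scalerA [qhalf _ * _]mulrC qhalf_mulN scale1r.
- by rewrite (weightN wp wD) (frame_opp hF hs); apply: integral_unitV.
Qed.

(* The weights of the cluster variables always form a basis of the value group,
   so the two terms of an exchange relation never have equal weight. *)
Lemma integral_frame_mutation k s s' w :
  is_quantum_seed d s -> is_quantum_seed d s' -> mutation k s s' ->
  is_weight w -> integral_frame s w ->
  exists2 w', is_weight w' & integral_frame s' w'.
Proof.
move=> hs hs' mu hw hsw; case: (hw) => wp wD wI.
case: (hw0) => w00 w0D w0I.
pose a := - evec k + \row_i pospart (exmx s i k).
pose b := - evec k + \row_i pospart (- exmx s i k).
have ab : a <> b := @mut_exponents_neq s k hs.
(* The heavier of the two exponents is m; its k-th entry is -1 because B has zero diagonal. *)
have [m mk hm] : exists2 m : 'rV[int]_n, m 0 k = -1 & iunit (w m) (mut_var k s).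
  have Bk := exmx_diag0 k hs.
  have ak : a 0 k = -1 by rewrite !mxE Bk !eqxx.
  have bk : b 0 k = -1 by rewrite !mxE Bk !eqxx.
  have [lt|gt|/wI//] := ltgtP (w a) (w b).
    exists b => //; rewrite /mut_var addrC.
    exact: (integral_unitD hF hs0 w00 w0D w0I lt).
  by exists a => //; apply: (integral_unitD hF hs0 w00 w0D w0I gt).
(* The linear map that sends the k-th basis vector to m and fixes the others. It negates the k-th
   coordinate, hence is injective. *)
pose phi e := e - e 0 k *: evec k + e 0 k *: m.
have phik e : phi e 0 k = - e 0 k.
  by rewrite !mxE mk !eqxx mulr1 subrr add0r mulrN1.
have hw' : is_weight (w \o phi).
  split=> [e|e f|e f /wI ef] /=; first exact: wp.
    rewrite -wD; congr w; rewrite /phi mxE !scalerDl opprD.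
    by rewrite [e + f + _]addrACA [LHS]addrACA.
  have efk : e 0 k = f 0 k by apply: oppr_inj; rewrite -!phik ef.
  by move: ef; rewrite /phi efk => /addIr/addIr.
exists (w \o phi) => //; apply: integral_frame_gen => // i /=.
rewrite (mutation_var mu).
have [->|ik] := eqVneq i k.
  have -> // : phi (evec k) = m.
  by rewrite /phi {2 3}/evec mxE !eqxx !scale1r subrr add0r.
have -> // : phi (evec i) = evec i.
by rewrite /phi {2 4}/evec mxE eq_sym (negbTE ik) !scale0r subr0 addr0.
Qed.

End Seeds.

(** * The quantum cluster algebra of a seed pattern *)

Section Pattern.
Variables (n : nat) (F : unitAlgType Zq) (hF : skew_field F).
Variables (d : 'rV[int]_n) (S : tree n -> seed n F).
Hypothesis hS : quantum_seed_pattern d S.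

Definition tree_root : tree n := exist _ [::] isT.

Local Notation s0 := (S tree_root).
Local Notation w0 := (@prime_weight n).

Lemma integral_frame_tree t :
  exists2 w, is_weight w & integral_frame s0 w0 (S t) w.
Proof.
case: t; elim=> [|k v IH] hv.
  exists w0; first exact: prime_weight_is_weight.
  have -> : exist _ [::] hv = tree_root by apply: val_inj.
  case: (prime_weight_is_weight n) => wp wD wI e.
  exact: (integral_unit_frame hF (pattern_seed hS _)).
have hv' : reduced_word v by apply: path_sorted hv.
have [w hw hsw] := IH hv'.
have mu : mutation k (S (exist _ v hv')) (S (exist _ (k :: v) hv)).
  by apply: (pattern_mut hS); left.
apply: (integral_frame_mutation hF (pattern_seed hS _) _ _ _ mu hw hsw);
  by [exact: pattern_seed hS _ | exact: prime_weight_is_weight].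
Qed.

Lemma cluster_algebra_integral (x : F) :
  alg_gen (is_cluster_var S) x -> integral s0 w0 x.
Proof.
have hs0 := pattern_seed hS tree_root.
case: (prime_weight_is_weight n) => wp wD wI.
elim=> [y [t [i ->]]|c|y z _ hy _ hz|y z _ hy _ hz].
- have [w _ h] := integral_frame_tree t; exact: iu_int (h (evec i)).
- exact: (integral_scalar hF hs0).
- exact: (integralD hF hs0).
- exact: (integralM hF hs0).
Qed.

Local Notation A := (quantum_cluster_algebra S).

Lemma val_integral (a : A) : integral s0 w0 (val a).
Proof. by apply: cluster_algebra_integral; apply/asboolP; case: a. Qed.

Lemma cluster_var_mem t i : cluster_var (S t) i \in subalg_pred (is_cluster_var S).
Proof. by apply/asboolP/AlgGen; exists t, i. Qed.

Definition cvar t i : A := exist _ (cluster_var (S t) i) (cluster_var_mem t i).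

Lemma commute_frame (s : seed n F) z : is_quantum_seed d s ->
  (forall i, GRing.comm z (cluster_var s i)) -> forall e, GRing.comm z (frame s e).
Proof.
move=> hs hz; apply: row_int_ind => // [|e f he hf|e].
- by rewrite (frame0 hF hs); apply: commr1.
- have := commrM he hf; rewrite (qseed_mul hs) /GRing.comm -scalerAl -scalerAr.
  exact/(skew_scaleI hF hs)/qhalf_neq0.
- by rewrite (frame_opp hF hs); apply: commrV.
Qed.

Lemma val_commutator (a b : A) :
  val (commutator a b) = commutator (val a) (val b).
Proof. by rewrite /commutator rmorphB !rmorphM. Qed.

Lemma central_cluster_frac (z : F) : (forall a : A, GRing.comm z (val a)) ->
  exists r p : Zq, r != 0 /\ r *: z = p%:A.
Proof.
move=> hz; have hs0 := pattern_seed hS tree_root.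
by apply: (central_frac hF hs0); apply: commute_frame hs0 _ => i; apply: (hz (cvar _ i)).
Qed.

End Pattern.

(** * The ratio of bracket and commutator, and its integrality *)

Lemma poisson_ratio n (F : unitAlgType Zq) (hF : skew_field F) (S : tree n -> seed n F)
    (br : quantum_cluster_algebra S -> quantum_cluster_algebra S ->
          quantum_cluster_algebra S) (c d : quantum_cluster_algebra S) :
  is_poisson br -> commutator c d != 0 ->
  exists l : F, (forall a : quantum_cluster_algebra S, GRing.comm l (val a)) /\
    forall a b : quantum_cluster_algebra S, val (br a b) = val (commutator a b) * l.
Proof.
move=> hbr cd0.
have u : val (commutator c d) \is a GRing.unit.
  by apply: hF; rewrite -(inj_eq val_inj) rmorph0 in cd0.
pose l := val (br c d) / val (commutator c d).
have mid (a b x : quantum_cluster_algebra S) :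
    val (br a b) * val x = val (commutator a b) * val x * l.
  rewrite mulrA; apply: (canRL (mulrK u)).
  have := congr1 val (poisson_commutator_mid hbr a b c d x).
  by rewrite !rmorphM.
have brE a b : val (br a b) = val (commutator a b) * l.
  by have := mid a b 1; rewrite rmorph1 !mulr1.
(* Centrality of l: compare x = 1 with general x in [mid] at the pair c, d and cancel the invertible
   commutator. *)
exists l; split=> // x; apply: (mulrI u).
by rewrite [LHS]mulrA [RHS]mulrA -brE mid.
Qed.

Theorem theorem1p4 (n : nat) (F : unitAlgType Zq) (hF : skew_field F)
  (d : 'rV[int]_n) (S : tree n -> seed n F) (hS : quantum_seed_pattern d S)
  (br : quantum_cluster_algebra S -> quantum_cluster_algebra S ->
        quantum_cluster_algebra S) :
  is_poisson br -> inner_poisson br -> standard_poisson br.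
Proof.
move=> hbr inn.
(* The ratio needs a nonzero commutator; in the commutative case an inner bracket is zero. *)
have [ab0|] := pselect (forall a b : quantum_cluster_algebra S, commutator a b = 0).
  by exists 0 => a b; rewrite scale0r; have [a' ->] := inn a; apply: ab0.
move=> /existsNP[c /existsNP[c' /eqP cc]].
have [l [lc brE]] := poisson_ratio hF hbr cc.
(* Without cluster variables the algebra consists of scalars, so it is commutative. *)
case: n => [|n] in d S hS br hbr inn c c' cc l lc brE *.
  case/eqP: cc; apply: val_inj; rewrite val_commutator rmorph0.
  have sc (x : quantum_cluster_algebra S) : exists k : Zq, val x = k%:A.
    case: x => x /asboolP /=.
    elim=> [y [t [[]]]//|k|y z _ [k ->] _ [k' ->]|y z _ [k ->] _ [k' ->]].
    - by exists k.
    - by exists (k + k'); rewrite scalerDl.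
    - by exists (k * k'); rewrite -scalerAl mul1r scalerA.
  have [k ->] := sc c; have [k' ->] := sc c'.
  by rewrite /commutator -!scalerAl !mul1r !scalerA mulrC subrr.
have hs0 := pattern_seed hS (tree_root _).
pose x1 := cvar S (tree_root _) 0.
have [a' br1] := inn x1.
(* Both a' and l X_1 induce the Hamiltonian of X_1 as their commutator, so y is central. *)
pose y := val a' - l * val x1.
have yc (b : quantum_cluster_algebra S) : GRing.comm y (val b).
  have := congr1 val (br1 b); rewrite brE !val_commutator /commutator => e.
  have h1 : l * val x1 * val b = val x1 * val b * l by rewrite lc -mulrA lc mulrA.
  have h2 : val b * (l * val x1) = val b * val x1 * l by rewrite lc mulrA.
  rewrite /GRing.comm /y mulrBl mulrBr h1 h2; apply/eqP.
  by rewrite subr_eq -addrA addrC -subr_eq -e mulrBl [X in _ == X]addrC.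
have [r [p [r0 lE]]] := central_cluster_frac hF hS lc.
have [r' [p' [r0' yE]]] := central_cluster_frac hF hS yc.
case: (prime_weight_is_weight n.+1) => wp wD wI.
have e0 : evec (0 : 'I_n.+1) <> 0.
  by move=> /rowP/(_ 0); rewrite !mxE !eqxx.
have [|k lk] := integral_coef hF hs0 wp wD wI e0 r0 r0' lE yE.
  have -> : l * frame (S (tree_root _)) (evec 0) + y = val a' by rewrite /y addrC subrK.
  exact: (val_integral hF hS).
exists k => a b; apply: val_inj; rewrite brE lk linearZ /=.
by rewrite -scalerAr mulr1.
Qed.
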